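(* Let $X$ be a metrizable space, and let $F$ be a non-empty closed subset of $X$ with $\dim_{\mathrm T}(X\setminus F)=0$. Fix $d\in \mathrm{Met}(X)$, and equip $X_{/F}$ with the topology generated by the metric $\Theta(d)$. Let $r\colon X\to F$ be a retraction satisfying conditions (D) and (SR) (stated in the context) with respect to $d$. Define a map $\Phi\colon X\to F\times X_{/F}$ by $\Phi(x)=(r(x),\pi(x))$. Then: (P1) $\Phi(a)=(a,\omega_F)$ for all $a\in F$; (P2) $\Phi$ is a topological embedding, and $\Phi(X)$ is a closed subset of $F\times X_{/F}$.
   Context: $\mathrm{Met}(X)$ is the set of all metrics on $X$ generating the given topology of the metrizable space $X$. For a topological space $Y$, $\dim_{\mathrm T}(Y)=0$ means that $Y\neq\emptyset$ and $Y$ has covering dimension $0$, i.e. every finite open covering of $Y$ has a refinement covering consisting of finitely many mutually disjoint open subsets. For $d\in\mathrm{Met}(X)$ and $A\subset X$, put $\varrho_{d,A}(x)=\inf_{y\in A}d(x,y)$. Metric quotient: for a non-empty closed subset $F$ of $X$, choose a point $\omega_F\in F$ and put $X_{/F}=(X\setminus F)\sqcup\{\omega_F\}$. For $d\in\mathrm{Met}(X)$ define $\Theta(d)\colon (X_{/F})^2\to[0,\infty)$ by $\Theta(d)(x,y)=\min\{d(x,y),\ \varrho_{d,F}(x)+\varrho_{d,F}(y)\}$; this is a metric on $X_{/F}$. Define $\pi\colon X\to X_{/F}$ by $\pi(x)=x$ if $x\in X\setminus F$ and $\pi(x)=\omega_F$ if $x\in F$. A retraction $r\colon X\to F$ is a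 continuous map with $r(a)=a$ for all $a\in F$. The conditions on $r$ with respect to $d$ are: (D) for every $\epsilon\in(0,\infty)$, the image $r(\{x\in X\mid \epsilon\le \varrho_{d,F}(x)\})$ is closed and discrete in $F$; (SR) if a sequence $\{x_i\}_{i\in\mathbb{Z}_{\ge0}}$ in $X$ satisfies $\lim_{i\to\infty}\varrho_{d,F}(x_i)=0$, then $\lim_{i\to\infty}d(x_i,r(x_i))=0$. By a theorem essentially due to Engelking, such a retraction exists for every $d\in\mathrm{Met}(X)$ whenever $F$ is a non-empty closed subset of $X$ and $\dim_{\mathrm T}(X\setminus F)=0$. *)

(* Defs.v *)
From HB Require Import structures.
From mathcomp Require Import all_boot all_order all_algebra.
From mathcomp Require Import lra.
From mathcomp Require Import all_classical all_reals all_analysis.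

Set Implicit Arguments.
Unset Strict Implicit.
Unset Printing Implicit Defensive.

Import Order.TTheory GRing.Theory Num.Theory.
Import numFieldTopology.Exports.

Local Open Scope classical_set_scope.
Local Open Scope ring_scope.

Record is_metric (R : realType) (T : Type) (d : T -> T -> R) : Prop := IsMetric {
  dist_ge0 : forall x y, 0 <= d x y;
  dist_eq0 : forall x y, d x y = 0 <-> x = y;
  dist_sym : forall x y, d x y = d y x;
  dist_triangle : forall x y z, d x z <= d x y + d y z
}.

Definition generates_topology (R : realType) (X : topologicalType)
    (d : X -> X -> R) : Prop :=
  forall U : set X, open U <->
    forall x, U x -> exists2 e : R, 0 < e & [set y | d x y < e] `<=` U.

Definition Met (R : realType) (X : topologicalType) : set (X -> X -> R) :=
  [set d | is_metric d /\ generates_topology d].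
Arguments Met : clear implicits.

Definition metrizable (R : realType) (X : topologicalType) : Prop :=
  Met R X !=set0.
Arguments metrizable : clear implicits.

Definition covdim0 (Y : topologicalType) : Prop :=
  [set: Y] !=set0 /\
  forall C : set (set Y), finite_set C -> C `<=` open -> cover C id = setT ->
    exists D : set (set Y), [/\ finite_set D, D `<=` open, cover D id = setT,
      (forall V, D V -> exists2 U, C U & V `<=` U) & trivIset D id].

Definition embedding (X Y : topologicalType) (f : X -> Y) : Prop :=
  [/\ continuous f, injective f &
      (* f is open onto its image with the subspace topology *)
      forall U, open U -> exists2 V, open V & f @` U = V `&` range f].

Section dist_to_set.
Variables (R : realType) (X : topologicalType).
Implicit Types (d : X -> X -> R) (A F : set X).

Definition dist_to d A (x : X) : R := inf [set d x y | y in A].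

Section retraction.
Variables (d : X -> X -> R) (F : set X) (r : X -> F).

Definition retraction : Prop := continuous r /\ forall a : F, r (\val a) = a.

Definition condD : Prop := forall e : R, 0 < e ->
  let A := r @` [set x | e <= dist_to d F x] in
  closed A /\ A `<=` isolated A.

Definition condSR : Prop := forall x : nat -> X,
  dist_to d F (x i) @[i --> \oo] --> (0 : R) ->
  d (x i) (\val (r (x i))) @[i --> \oo] --> (0 : R).

End retraction.

Lemma dist_to_lb d F (x : X) : is_metric d -> has_lbound [set d x y | y in F].
Proof. by move=> md; exists 0 => _ [y _ <-]; exact: dist_ge0. Qed.

Lemma dist_to_le d F (x y : X) : is_metric d -> F y -> dist_to d F x <= d x y.
Proof. by move=> md Fy; apply: ge_inf; [exact: dist_to_lb|exists y]. Qed.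

Lemma dist_to_ge0 d F (x : X) : is_metric d -> F !=set0 -> 0 <= dist_to d F x.
Proof.
move=> md [y Fy]; apply: lb_le_inf; first by exists (d x y), y.
by move=> _ [z _ <-]; exact: dist_ge0.
Qed.

Lemma dist_to_lip d F (x y : X) : is_metric d -> F !=set0 ->
  dist_to d F x <= d x y + dist_to d F y.
Proof.
move=> md [z Fz]; rewrite -lerBlDl.
apply: lb_le_inf; first by exists (d y z), z.
move=> _ [t Ft <-]; rewrite lerBlDl.
exact: le_trans (dist_to_le x md Ft) (dist_triangle md x y t).
Qed.

Lemma dist_to_eq0 d F (x : X) : Met R X d -> closed F -> F !=set0 ->
  dist_to d F x = 0 -> F x.
Proof.
move=> [md td] cF [z Fz] dx0; apply: contrapT => nFx.
have [e e0 xeF] := (td (~` F)).1 (closed_openC cF) x nFx.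
suff : e <= dist_to d F x by rewrite dx0 leNgt e0.
apply: lb_le_inf; first by exists (d x z), z.
move=> _ [t Ft <-]; rewrite leNgt; apply/negP => dxt.
exact: (xeF t dxt).
Qed.

Lemma dist_to0 d F (x : X) : is_metric d -> F x -> dist_to d F x = 0.
Proof.
move=> md Fx; apply/eqP; rewrite eq_le dist_to_ge0 ?andbT//; last by exists x.
by rewrite -((dist_eq0 md x x).2 erefl) dist_to_le.
Qed.

End dist_to_set.

Section metric_quotient.
Variables (R : realType) (X : topologicalType).

Definition Theta (d : X -> X -> R) (F : set X) (x y : X) : R :=
  Num.min (d x y) (dist_to d F x + dist_to d F y).

(* (X \ F) |_| {w}, with w in F. The metric, the closedness of F and the point
   w are parameters so that the Theta-metric is the canonical metricType
   structure of this type, and not the subspace topology inherited from X. *)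
Definition metric_quotient (d : X -> X -> R) (F : set X)
    (dMet : Met R X d) (cF : closed F) (w : F) : Type :=
  set_type (~` F `|` [set \val w]).

Variables (d : X -> X -> R) (F : set X).
Variables (dMet : Met R X d) (cF : closed F) (w : F).

Local Notation Q := (metric_quotient dMet cF w).

HB.instance Definition _ := Choice.copy Q (set_type (~` F `|` [set \val w])).

Definition mq_val (x : Q) : X := set_val x.

Definition mq_dist (x y : Q) : R := Theta d F (mq_val x) (mq_val y).

Let md : is_metric d := dMet.1.

Let F0 : F !=set0. Proof. by exists (\val w); exact: set_valP. Qed.

Let rho_ge0 x : 0 <= dist_to d F x. Proof. exact: dist_to_ge0. Qed.

Lemma mq_distxx x : mq_dist x x = 0.
Proof.
by rewrite /mq_dist /Theta (dist_eq0 md _ _).2//; apply: min_idPl; rewrite addr_ge0.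
Qed.

Lemma mq_dist_sym x y : mq_dist x y = mq_dist y x.
Proof. by rewrite /mq_dist /Theta (dist_sym md) addrC. Qed.

Lemma mq_val_rho0 (x : Q) : dist_to d F (mq_val x) = 0 -> mq_val x = \val w.
Proof. by move/(dist_to_eq0 dMet cF F0) => Fx; case: (set_valP x). Qed.

Lemma mq_dist_eq0 x y : mq_dist x y = 0 -> x = y.
Proof.
rewrite /mq_dist /Theta => dxy; apply: val_inj; move: dxy.
rewrite -[val x]/(mq_val x) -[val y]/(mq_val y).
case: leP => _; first by move/(dist_eq0 md _ _).1.
move/eqP; rewrite paddr_eq0// => /andP[/eqP x0 /eqP y0].
by rewrite (mq_val_rho0 x0) (mq_val_rho0 y0).
Qed.

Lemma mq_dist_triangle y x z : mq_dist x z <= mq_dist x y + mq_dist y z.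
Proof.
rewrite /mq_dist /Theta.
move: (mq_val x) (mq_val y) (mq_val z) => {}x {}y {}z.
have xyz := dist_triangle md x y z.
have xy := dist_to_lip x y md F0.
have zy := dist_to_lip z y md F0; rewrite (dist_sym md) in zy.
have y0 := rho_ge0 y.
by rewrite ge_min; apply/orP; case: (leP (d x y)) => ?; case: (leP (d y z)) => ?;
  [left|right|right|right]; lra.
Qed.

HB.instance Definition _ := isMetric.Build R Q
  mq_distxx mq_dist_eq0 mq_dist_sym mq_dist_triangle.

Lemma mq_mdistE (x y : Q) : mdist x y = Theta d F (mq_val x) (mq_val y).
Proof. by []. Qed.

Lemma mq_generates_topology : generates_topology mq_dist.
Proof.
have nbhsxP (x : Q) (U : set Q) : nbhs x U <->
    exists2 e : R, 0 < e & [set y | mq_dist x y < e] `<=` U.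
  by rewrite -filter_from_ballE; split=> -[e e0] /= xeU; exists e => //; move: xeU; rewrite /= ballEmdist.
move=> U; rewrite openE; split => [oU x /oU /nbhsxP//|HU x /HU xU].
exact/nbhsxP.
Qed.

Definition mq_point : Q := SigSub (mem_set (or_intror (erefl (\val w)))).

Definition mq_proj (x : X) : Q :=
  match pselect (F x) with
  | left _ => mq_point
  | right nFx => SigSub (mem_set (or_introl nFx))
  end.

Lemma mq_val_point : mq_val mq_point = \val w. Proof. by []. Qed.

Lemma mq_projF x : F x -> mq_proj x = mq_point.
Proof. by rewrite /mq_proj; case: pselect. Qed.

Lemma mq_proj_notF x : ~ F x -> mq_val (mq_proj x) = x.
Proof. by rewrite /mq_proj; case: pselect. Qed.

End metric_quotient.

(* Main.v *)
Require Import Defs.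
From HB Require Import structures.
From mathcomp Require Import all_boot all_order all_algebra.
From mathcomp Require Import lra.
From mathcomp Require Import all_classical all_reals all_analysis.

Set Implicit Arguments.
Unset Strict Implicit.
Unset Printing Implicit Defensive.

Import Order.TTheory GRing.Theory Num.Theory.
Import numFieldTopology.Exports.

Local Open Scope classical_set_scope.
Local Open Scope ring_scope.

(** The map [Phi] is continuous and injective, so everything follows once it is
    known to be a closed map ([closed_map_embedding]).

    The quotient metric between [pi x] and [pi y] is [Theta d F x y] for all
    [x] and [y], whichever of them lie in [F] ([mq_dist_proj]); in particular
    the distance from [pi y] to the collapsed point is the distance from [y]
    to [F].  Let [C] be closed and let [(a, q)] be adherent to [Phi @` C].

    - If [q] is the collapsed point, there are points [y] of [C] as close to [F]
      as desired with [r y] close to [a].  Condition (SR) makes [y] close to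
      [r y], hence to [a], so [a] lies in [C] and [Phi a = (a, q)].
    - Otherwise [q] is a point of [X] at positive distance from [F], and
      near [q] the quotient metric coincides with [d].  Hence there are points
      [y] of [C] that are [d]-close to [q] with [r y] close to [a]: thus [q]
      lies in [C], and [a = r q] by continuity of [r]. *)

(** * Metrics generating a topology *)

Section generating_metric.
Variables (R : realType) (X : topologicalType) (d : X -> X -> R).
Hypothesis dMet : Met R X d.

Lemma nbhs_dist_lt (x : X) (e : R) : 0 < e -> nbhs x [set y | d x y < e].
Proof.
case: dMet => md td e0; apply: open_nbhs_nbhs; split; last first.
  by rewrite /= (dist_eq0 md x x).2.
apply/td => y /= xy; exists (e - d x y); first by rewrite subr_gt0.
move=> z /= yz; have := dist_triangle md x y z; lra.
Qed.

Lemma nbhs_distP (x : X) (U : set X) :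
  nbhs x U -> exists2 e : R, 0 < e & [set y | d x y < e] `<=` U.
Proof.
rewrite nbhsE => -[V [oV Vx] VU].
by have [e e0 eV] := (dMet.2 V).1 oV x Vx; exists e => // y /eV /VU.
Qed.

Lemma closed_dist (C : set X) (x : X) : closed C ->
  (forall e : R, 0 < e -> exists2 y, C y & d x y < e) -> C x.
Proof.
move=> cC Cx; apply: cC => U /nbhs_distP[e e0 eU].
by have [y Cy xy] := Cx e e0; exists y; split => //; exact: eU.
Qed.

End generating_metric.

Lemma nbhs_subtype_dist_lt (R : realType) (X : topologicalType)
    (d : X -> X -> R) (F : set X) (a : F) (e : R) :
  Met R X d -> 0 < e -> nbhs a [set b : F | d (\val a) (\val b) < e].
Proof.
move=> dMet e0.
exact: (@initial_continuous F X set_val a _ (nbhs_dist_lt dMet _ e0)).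
Qed.

(** * Closed maps *)

(** By injectivity, the image of an open set [U] is the trace on the range of
    the complement of [f @` (~` U)], which is open when [f] is closed. *)
Lemma closed_map_embedding (X Y : topologicalType) (f : X -> Y) :
  continuous f -> injective f -> (forall C, closed C -> closed (f @` C)) ->
  embedding f /\ closed (range f).
Proof.
move=> cf fI fC; split; last by apply: fC; exact: closedT.
split=> // U oU; exists (~` (f @` (~` U))).
  by apply: closed_openC; apply: fC; exact: open_closedC.
apply/seteqP; split=> [y [x Ux <-]|y [nfU [x _ xE]]].
  by split; [move=> [z nUz /fI zx]; apply: nUz; rewrite zx|exists x].
by exists x => //; apply: contrapT => nUx; apply: nfU; exists x.
Qed.

(** * Condition (SR) and the quotient metric *)

(** Otherwise choosing, for each [n], a point at distance less than [1/(n+1)]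
    from [F] and moved by at least [e] yields a sequence contradicting (SR). *)
Lemma condSR_uniform (R : realType) (X : topologicalType) (d : X -> X -> R)
    (F : set X) (r : X -> F) : is_metric d -> F !=set0 -> condSR d r ->
  forall e : R, 0 < e -> exists2 del : R, 0 < del &
    forall x, dist_to d F x < del -> d x (\val (r x)) < e.
Proof.
move=> md F0 SR e e0; apply: contrapT => Hn.
have Hx n : exists x, dist_to d F x < n.+1%:R^-1 /\ e <= d x (\val (r x)).
  apply: contrapT => nx; apply: Hn; exists (n.+1%:R^-1) => [|x xn].
    by rewrite invr_gt0.
  by rewrite ltNge; apply/negP => ex; apply: nx; exists x.
have [x xP] := choice Hx.
have rho0 : dist_to d F (x i) @[i --> \oo] --> (0 : R).
  apply: (@squeeze_cvgr _ _ _ _ (fun=> 0) (@harmonic R)).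
  - by near=> i; rewrite dist_to_ge0//= ltW//; exact: (xP i).1.
  - exact: cvg_cst.
  - exact: cvg_harmonic.
have /cvgrPdist_lt/(_ e e0)[N _ /(_ N)] := SR x rho0.
move=> /(_ (leqnn N)) /=; rewrite sub0r normrN ger0_norm ?dist_ge0//.
by rewrite ltNge (xP N).2.
Unshelve. all: by end_near. Qed.

Section quotient_metric.
Variables (R : realType) (X : topologicalType) (F : set X).
Variables (d : X -> X -> R) (dMet : Met R X d) (cF : closed F) (w : F).
Local Notation Q := (metric_quotient dMet cF w).
Local Notation pi := (mq_proj dMet cF w).

Let md : is_metric d := dMet.1.
Let F0 : F !=set0. Proof. by exists (\val w); exact: set_valP. Qed.

Lemma mq_dist_Met : Met R Q (@mq_dist R X d F dMet cF w).
Proof.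
split; last exact: mq_generates_topology.
split.
- by move=> x y; rewrite /mq_dist /Theta le_min dist_ge0//= addr_ge0// dist_to_ge0.
- by move=> x y; split=> [/mq_dist_eq0//|->]; exact: mq_distxx.
- exact: mq_dist_sym.
- by move=> x y z; exact: mq_dist_triangle.
Qed.

Lemma Theta_sym x y : Theta d F x y = Theta d F y x.
Proof. by rewrite /Theta (dist_sym md) addrC. Qed.

Lemma ThetaF x y : F x -> Theta d F x y = dist_to d F y.
Proof.
move=> Fx; rewrite /Theta dist_to0// add0r; apply/min_idPr.
by rewrite (dist_sym md) dist_to_le.
Qed.

(** [Theta d F] does not distinguish the points of [F] from one another, so it
    is the pullback of the quotient metric to all of [X]. *)
Lemma mq_dist_proj x y : mq_dist (pi x) (pi y) = Theta d F x y.
Proof.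
have Fw : F (\val w) := set_valP w.
rewrite /mq_dist.
have projE z t : Theta d F (mq_val (pi z)) t = Theta d F z t.
  have [Fz|nFz] := pselect (F z); last by rewrite mq_proj_notF.
  by rewrite mq_projF// mq_val_point !ThetaF.
by rewrite projE Theta_sym projE Theta_sym.
Qed.

Lemma mq_proj_continuous : continuous pi.
Proof.
move=> x U /(nbhs_distP mq_dist_Met)[e e0 eU].
apply: filterS (nbhs_dist_lt dMet x e0) => y /= xy; apply: eU => /=.
by rewrite mq_dist_proj; apply: le_lt_trans xy; rewrite /Theta ge_min lexx.
Qed.

Lemma mq_proj_inj x y : pi x = pi y -> x = y \/ F x /\ F y.
Proof.
move=> pxy; have : Theta d F x y = 0.
  by rewrite -mq_dist_proj pxy; exact: mq_distxx.
rewrite /Theta; case: leP => _; first by move/(dist_eq0 md _ _).1; left.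
move/eqP; rewrite paddr_eq0 ?dist_to_ge0// => /andP[/eqP x0 /eqP y0].
by right; split; apply: (dist_to_eq0 dMet).
Qed.

Lemma mq_proj_surj (q : Q) : exists x, q = pi x.
Proof.
exists (mq_val q); have [Fq|nFq] := pselect (F (mq_val q)).
  rewrite mq_projF//; apply: val_inj => /=.
  by case: (set_valP q).
by apply: val_inj; exact/esym/mq_proj_notF.
Qed.

Variable r : X -> F.
Hypotheses (rr : retraction r) (r_SR : condSR d r).
Local Notation Phi := (fun x => (r x, pi x)).

Lemma pair_retraction_proj_continuous : continuous (Phi : X -> F * Q).
Proof. move=> x; exact: cvg_pair (rr.1 x) (@mq_proj_continuous x). Qed.

Lemma pair_retraction_proj_inj : injective Phi.
Proof.
move=> x y [rxy /mq_proj_inj[//|[Fx Fy]]].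
have rF z (Fz : F z) : \val (r z) = z.
  by have /(congr1 val) := rr.2 (SigSub (mem_set Fz)).
by rewrite -(rF x Fx) -(rF y Fy) rxy.
Qed.

Section adherent_point.
Variables (C : set X) (a : F) (x : X).
Hypotheses (cC : closed C) (clx : closure (Phi @` C) ((a, pi x) : F * Q)).

Lemma adherent_approx e e' : 0 < e -> 0 < e' -> exists y,
  [/\ C y, d (\val a) (\val (r y)) < e & Theta d F x y < e'].
Proof.
move=> e0 e'0.
have [_ [[y Cy <-] [/= ay xy]]] : (Phi @` C `&`
    ([set b : F | d (\val a) (\val b) < e] `*`
     [set z : Q | mq_dist (pi x) z < e'])) !=set0.
  apply: clx; exists ([set b : F | d (\val a) (\val b) < e],
                      [set z : Q | mq_dist (pi x) z < e']) => //=.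
  by split; [exact: nbhs_subtype_dist_lt|exact: (nbhs_dist_lt mq_dist_Met)].
by exists y; split => //; rewrite -mq_dist_proj.
Qed.

(** A point [y] with [pi y] near [pi x] is near [F], so (SR) brings it near its
    own retract [r y], and [r y] is near [a]. *)
Lemma adherent_in_F : F x -> (Phi @` C) (a, pi x).
Proof.
move=> Fx; exists (\val a); last first.
  by rewrite rr.2 !mq_projF//; exact: set_valP.
apply: (closed_dist dMet cC) => e e0.
have e20 : 0 < e / 2 by lra.
have [del del0 delP] := condSR_uniform md F0 r_SR e20.
have [y [Cy ay]] := adherent_approx e20 del0.
rewrite ThetaF// => /delP yry; exists y => //.
have := dist_triangle md (\val a) (\val (r y)) y.
by rewrite (dist_sym md (\val (r y)) y); lra.
Qed.

(** Away from [F] the quotient map is a local isometry, so [x] is a limit of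
    points [y] of [C] with [r y] near [a], and continuity of [r] forces
    [a = r x]. *)
Lemma adherent_notin_F : ~ F x -> (Phi @` C) (a, pi x).
Proof.
move=> nFx.
have rho_gt0 : 0 < dist_to d F x.
  rewrite lt_neqAle dist_to_ge0// andbT eq_sym.
  by apply/eqP => /(dist_to_eq0 dMet cF F0).
(* a value of [Theta d F x y] below [dist_to d F x] can only be [d x y] *)
have approx (e : R) : 0 < e -> exists y,
    [/\ C y, d (\val a) (\val (r y)) < e & d x y < e].
  move=> e0; have m0 : 0 < Num.min e (dist_to d F x) by rewrite lt_min e0.
  have [y [Cy ay]] := adherent_approx e0 m0.
  rewrite lt_min => /andP[xye xyF]; exists y; split=> //; move: xye xyF.
  have := dist_to_ge0 y md F0.
  by rewrite /Theta; case: (leP (d x y)) => ? ? ? ?; lra.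
exists x; first by apply: (closed_dist dMet cC) => e /approx[y []]; exists y.
congr (_, _); apply: val_inj; apply/esym/(dist_eq0 md _ _).1/eqP.
rewrite eq_le dist_ge0// andbT; apply/ler_addgt0Pr => e e0; rewrite add0r.
have e20 : 0 < e / 2 by lra.
have [del del0 delP] :=
  nbhs_distP dMet (rr.1 x _ (nbhs_subtype_dist_lt (r x) dMet e20)).
have m0 : 0 < Num.min (e / 2) del by rewrite lt_min e20.
have [y [_]] := approx _ m0; rewrite !lt_min => /andP[ay _] /andP[_ /delP /= xy].
have := dist_triangle md (\val a) (\val (r y)) (\val (r x)).
by rewrite (dist_sym md (\val (r y)) (\val (r x))); lra.
Qed.

End adherent_point.

Lemma pair_retraction_proj_closed (C : set X) :
  closed C -> closed (Phi @` C : set (F * Q)).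
Proof.
move=> cC [a q]; have [x ->] := mq_proj_surj q => clx.
have [Fx|nFx] := pselect (F x); first exact: adherent_in_F.
exact: adherent_notin_F.
Qed.

End quotient_metric.

Theorem theorem3p1 (R : realType) (X : topologicalType)
    (X_metrizable : metrizable R X)
    (F : set X) (F_neq0 : F !=set0) (F_closed : closed F)
    (dim0 : covdim0 (set_type (~` F)))
    (d : X -> X -> R) (dMet : Met R X d) (w : set_type F)
    (r : X -> set_type F) (r_retraction : retraction r)
    (r_D : condD d r) (r_SR : condSR d r) :
  let Phi : X -> set_type F * metric_quotient dMet F_closed w :=
    fun x => (r x, mq_proj dMet F_closed w x) in
  (forall a : set_type F, Phi (\val a) = (a, mq_point dMet F_closed w)) /\
  (embedding Phi /\ closed (range Phi)).
Proof.
move=> Phi; split=> [a|].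
  by rewrite /Phi r_retraction.2 mq_projF//; exact: set_valP.
apply: closed_map_embedding.
- exact: pair_retraction_proj_continuous.
- exact: pair_retraction_proj_inj.
- exact: pair_retraction_proj_closed.
Qed.
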